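(* Every approximate design that is E-optimal in the fixed effects model is E-optimal for the prediction of individual parameters in the random coefficients regression model. That is, if $\xi^*$ is an approximate design with non-singular $\mathbf{M}(\xi^* )$ which minimizes the largest eigenvalue of $\mathbf{M}(\xi)^{-1}$ over all approximate designs $\xi$ on $\mathcal{X}$ with non-singular $\mathbf{M}(\xi)$, then $\xi^*$ minimizes the largest eigenvalue of $\mathrm{MSE}(\xi)$ over all approximate designs $\xi$ on $\mathcal{X}$ with non-singular $\mathbf{M}(\xi)$.
   Context: Random coefficients regression model: $Y_{ij}=\mathbf{f}(x_j)^\top\boldsymbol{\beta}_i+\varepsilon_{ij}$, $j=1,\dots,m$, $i=1,\dots,n$, with $m,n\ge 1$, experimental region $\mathcal{X}$, known regression functions $\mathbf{f}=(f_1,\dots,f_p)^\top:\mathcal{X}\to\mathbb{R}^p$, uncorrelated zero-mean errors of variance $\sigma^2>0$, and individual parameters $\boldsymbol{\beta}_i$ with unknown mean and $\mathrm{Cov}(\boldsymbol{\beta}_i)=\sigma^2\mathbf{D}$, where $\mathbf{D}$ is a known (symmetric) positive definite $p\times p$ matrix. Put $\mathbf{\Delta}=m\,\mathbf{D}$. An approximate design $\xi$ consists of finitely many distinct points $x_1,\dots,x_k\in\mathcal{X}$ with weights $w_j\ge 0$, $\sum_{j=1}^k w_j=1$. Its (fixed effects, standardized) information matrix is $\mathbf{M}(\xi)=\sum_{j=1}^k w_j\,\mathbf{f}(x_j)\mathbf{f}(x_j)^\top$, assumed non-singular. The (standardized) mean squared error matrix for the best linear unbiased prediction of $(\boldsymbol{\beta}_1^\top,\dots,\boldsymbol{\beta}_n^\top)^\top$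 is the $np\times np$ matrix $$\mathrm{MSE}(\xi)=\tfrac1n\left(\mathbf{1}_n\mathbf{1}_n^\top\right)\otimes\mathbf{M}(\xi)^{-1}+\left(\mathbf{I}_n-\tfrac1n\mathbf{1}_n\mathbf{1}_n^\top\right)\otimes\left(\mathbf{M}(\xi)+\mathbf{\Delta}^{-1}\right)^{-1},$$ where $\mathbf{1}_n$ is the all-ones vector of length $n$, $\mathbf{I}_n$ the identity matrix, and $\otimes$ the Kronecker product. E-optimality in the fixed effects model means minimizing the largest eigenvalue of $\mathbf{M}(\xi)^{-1}$; E-optimality for the prediction means minimizing the largest eigenvalue of $\mathrm{MSE}(\xi)$. *)

(* Defs.v *)
From HB Require Import structures.
From mathcomp Require Import all_boot all_order all_algebra.
From mathcomp Require Import mxtens reals.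

Set Implicit Arguments.
Unset Strict Implicit.
Unset Printing Implicit Defensive.

Import Order.TTheory GRing.Theory Num.Theory.
Local Open Scope ring_scope.

Record design (R : realType) (X : Type) := Design {
  supp_size : nat;
  point : 'I_supp_size -> X;
  weight : 'I_supp_size -> R;
  point_inj : injective point;
  weight_ge0 : forall j, 0 <= weight j;
  weight_sum1 : \sum_(j < supp_size) weight j = 1 }.

Arguments point {R X}.
Arguments weight {R X}.

Definition posdefmx (R : realType) (p : nat) (D : 'M[R]_p) : Prop :=
  D^T = D /\ forall v : 'cV[R]_p, v != 0 -> 0 < (v^T *m D *m v) 0 0.

Definition infomx (R : realType) (X : Type) (p : nat) (f : X -> 'cV[R]_p)
    (xi : design R X) : 'M[R]_p :=
  \sum_(j < supp_size xi)
     weight xi j *: (f (point xi j) *m (f (point xi j))^T).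

(* J is (1/n) 1_n 1_n^T; *t is the Kronecker product. *)
Definition msemx (R : realType) (X : Type) (p : nat) (f : X -> 'cV[R]_p)
    (n : nat) (Delta : 'M[R]_p) (xi : design R X) : 'M[R]_(n * p) :=
  let ones : 'cV[R]_n := const_mx 1 in
  let J : 'M[R]_n := n%:R^-1 *: (ones *m ones^T) in
  J *t invmx (infomx f xi)
  + (1%:M - J) *t invmx (infomx f xi + invmx Delta).

Definition largest_eigenvalue (R : realType) (q : nat) (A : 'M[R]_q) (l : R) :
    Prop :=
  eigenvalue A l /\ forall a, eigenvalue A a -> a <= l.

(* xi minimizes the largest eigenvalue of C over the designs with non-singular
   information matrix.  C is meant to take symmetric values there, so that the
   largest (real) eigenvalue of C xi' exists for every competitor xi'. *)
Definition E_optimal (R : realType) (X : Type) (p q : nat)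
    (f : X -> 'cV[R]_p) (C : design R X -> 'M[R]_q) (xi : design R X) : Prop :=
  infomx f xi \in unitmx /\
  exists2 l, largest_eigenvalue (C xi) l &
    forall (xi' : design R X) (l' : R),
      infomx f xi' \in unitmx -> largest_eigenvalue (C xi') l' -> l <= l'.

Definition E_optimal_fixed (R : realType) (X : Type) (p : nat)
    (f : X -> 'cV[R]_p) : design R X -> Prop :=
  E_optimal f (fun xi => invmx (infomx f xi)).

(* Delta = m D *)
Definition E_optimal_prediction (R : realType) (X : Type) (p : nat)
    (f : X -> 'cV[R]_p) (m n : nat) (D : 'M[R]_p) : design R X -> Prop :=
  E_optimal f (msemx f n (m%:R *: D)).

(* Main.v *)
(* The spectrum of [MSE xi] is contained in the union of the spectra of
   [M^-1] and [(M + Delta^-1)^-1], and it contains the spectrum of [M^-1].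
   Since [M <= M + Delta^-1] in the Loewner order, the eigenvalues of
   [(M + Delta^-1)^-1] do not exceed the largest eigenvalue of [M^-1], so
   [MSE xi] and [M^-1] have the same largest eigenvalue and the two optimality
   criteria coincide. *)
Require Import Defs.
From mathcomp Require Import all_boot all_order all_algebra.
From mathcomp Require Import mxtens classical_sets reals ring lra.

Import Order.TTheory GRing.Theory Num.Theory.
Local Open Scope ring_scope.

(** Row vectors match [eigenvalue], whose eigenvectors act from the left; [bilin 1%:M u u] serves as
    the squared Euclidean norm. *)
Definition bilin {R : realType} {p : nat} (A : 'M[R]_p) (u v : 'rV[R]_p) : R :=
  (u *m A *m v^T) 0 0.

Definition psdmx {R : realType} {p : nat} (A : 'M[R]_p) : Prop :=
  A^T = A /\ forall u, 0 <= bilin A u u.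

Lemma eigenvalue_unitmx {F : fieldType} {p : nat} (A : 'M[F]_p) a :
  eigenvalue A a = (A - a%:M \notin unitmx).
Proof. by rewrite -row_free_unit -kermx_eq0. Qed.

(** * Quadratic forms, Cauchy-Schwarz and Rayleigh quotients *)

Section BilinearForm.
Context {R : realType} {p : nat}.
Implicit Types (A B : 'M[R]_p) (u v w : 'rV[R]_p).

Lemma bilinDm A B u v : bilin (A + B) u v = bilin A u v + bilin B u v.
Proof. by rewrite /bilin mulmxDr mulmxDl mxE. Qed.

Lemma bilinNm A u v : bilin (- A) u v = - bilin A u v.
Proof. by rewrite /bilin mulmxN mulNmx mxE. Qed.

Lemma bilinZm a A u v : bilin (a *: A) u v = a * bilin A u v.
Proof. by rewrite /bilin -scalemxAr -scalemxAl mxE. Qed.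

Lemma bilinDl A u v w : bilin A (u + v) w = bilin A u w + bilin A v w.
Proof. by rewrite /bilin !mulmxDl mxE. Qed.

Lemma bilinZl A a u w : bilin A (a *: u) w = a * bilin A u w.
Proof. by rewrite /bilin -!scalemxAl mxE. Qed.

Lemma bilinC A u v : A^T = A -> bilin A u v = bilin A v u.
Proof.
move=> sA; rewrite /bilin.
have -> : u *m A *m v^T = (v *m A *m u^T)^T.
  by rewrite !trmx_mul trmxK sA mulmxA.
by rewrite mxE.
Qed.

Lemma bilin_mulmxl A B u v : bilin A (u *m B) v = bilin (B *m A) u v.
Proof. by rewrite /bilin !mulmxA. Qed.

Lemma bilin1E u : bilin 1%:M u u = \sum_i u 0 i ^+ 2.
Proof.
by rewrite /bilin mulmx1 mxE; apply: eq_bigr => i _; rewrite mxE expr2.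
Qed.

Lemma bilin1_ge0 u : 0 <= bilin 1%:M u u.
Proof. by rewrite bilin1E sumr_ge0 // => i _; rewrite sqr_ge0. Qed.

Lemma bilin1_gt0 u : u != 0 -> 0 < bilin 1%:M u u.
Proof.
move=> u0; rewrite lt_neqAle bilin1_ge0 andbT eq_sym bilin1E.
apply: contra u0; rewrite psumr_eq0 => [/allP h|i _]; last exact: sqr_ge0.
apply/eqP/rowP => i; rewrite mxE; apply/eqP.
by rewrite -sqrf_eq0 (implyP (h i (mem_index_enum i))).
Qed.

Lemma bilin_bounded A :
  exists2 C, 0 < C & forall u, bilin A u u <= C * bilin 1%:M u u.
Proof.
(* The summand 1 keeps the constant positive even for [A = 0]. *)
exists (1 + \sum_i \sum_j `|A j i|).
  by rewrite ltr_pwDl ?ltr01 // sumr_ge0 // => i _; rewrite sumr_ge0.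
move=> u; set s := bilin 1%:M u u.
have le_s i : u 0 i ^+ 2 <= s.
  rewrite /s bilin1E (bigD1 i) //= lerDl sumr_ge0 // => j _; exact: sqr_ge0.
have -> : bilin A u u = \sum_i \sum_j u 0 j * A j i * u 0 i.
  by rewrite /bilin mxE; apply: eq_bigr => i _; rewrite !mxE mulr_suml.
rewrite mulrDl mul1r -[leLHS]add0r lerD ?bilin1_ge0 // mulr_suml.
apply: ler_sum => i _; rewrite mulr_suml; apply: ler_sum => j _.
apply: le_trans (ler_norm _) _; rewrite mulrAC mulrC normrM.
apply: ler_wpM2l => //; rewrite ler_norml.
(* The bound [|u_j u_i| <= s] follows from [2 |u_j u_i| <= u_j^2 + u_i^2 <= 2 s]. *)
have := le_s i; have := le_s j.
have := sqr_ge0 (u 0 i + u 0 j); have := sqr_ge0 (u 0 i - u 0 j).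
by move=> *; apply/andP; split; nra.
Qed.

Lemma psdmx_cauchy_schwarz A u v :
  psdmx A -> bilin A u v ^+ 2 <= bilin A u u * bilin A v v.
Proof.
move=> [sA psA]; have vu := bilinC _ v u sA.
have q s t : 0 <= s ^+ 2 * bilin A u u + 2 * s * t * bilin A u v
                  + t ^+ 2 * bilin A v v.
  have := psA (s *: u + t *: v).
  rewrite !(bilinDl, bilinZl) !(bilinC _ _ (_ + _) sA) !(bilinDl, bilinZl) vu.
  by congr (0 <= _); ring.
have := psA v; rewrite le_eqVlt => /orP[/eqP c0|c0].
  (* If [v] is isotropic, this choice of coefficients reduces [q] to [0 <= - (bilin A u v)^2]. *)
  have := q (bilin A u v) (- (bilin A u u + 1) / 2).
  rewrite -c0; move: (bilin A u u) (bilin A u v) => a b h.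
  by rewrite mulr0; nra.
(* With [a], [b], [c] the values at [(u,u)], [(u,v)], [(v,v)], this choice gives
   [0 <= c (a c - b^2)], and [c] is positive. *)
have := q (bilin A v v) (- bilin A u v).
move: (bilin A u u) (bilin A u v) (bilin A v v) c0 => a b c c0 h.
rewrite -subr_ge0 -(pmulr_rge0 _ c0); apply: le_trans h _.
by rewrite le_eqVlt; apply/orP; left; apply/eqP; ring.
Qed.

Lemma invmx_sym A : A^T = A -> (invmx A)^T = invmx A.
Proof. by move=> sA; rewrite trmx_inv sA. Qed.

Lemma bilin_invmx A u : A^T = A -> A \in unitmx ->
  bilin A (u *m invmx A) (u *m invmx A) = bilin (invmx A) u u.
Proof.
move=> sA uA; rewrite bilin_mulmxl mulVmx // bilinC ?trmx1 //.
by rewrite bilin_mulmxl mulmx1.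
Qed.

(* Cauchy-Schwarz for the form of [A] applied to [u] and [u A^-1]. *)
Lemma psdmx_inv_cauchy_schwarz A u : psdmx A -> A \in unitmx ->
  bilin 1%:M u u ^+ 2 <= bilin A u u * bilin (invmx A) u u.
Proof.
move=> psA uA; have := psdmx_cauchy_schwarz _ u (u *m invmx A) psA.
by rewrite bilin_invmx ?psA.1 // bilinC ?psA.1 // bilin_mulmxl mulVmx.
Qed.

(** A zero value at [u] would force the fourth power of the norm of [u] to be at most 0. *)
Lemma psdmx_unit_gt0 A u : psdmx A -> A \in unitmx -> u != 0 -> 0 < bilin A u u.
Proof.
move=> psA uA u0; rewrite lt_neqAle psA.2 andbT eq_sym.
apply/eqP => q0; have := psdmx_inv_cauchy_schwarz _ u psA uA.
by rewrite q0 mul0r leNgt exprn_gt0 // bilin1_gt0.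
Qed.

Lemma bilin_gt0_unit A : (forall u, u != 0 -> 0 < bilin A u u) -> A \in unitmx.
Proof.
move=> pA; rewrite -row_free_unit -kermx_eq0; apply/negPn/negP => /rowV0Pn[v].
move=> /sub_kermxP vA /pA; by rewrite /bilin vA mul0mx mxE ltxx.
Qed.

(* If the supremum [mu] of the Rayleigh quotients were not an eigenvalue,
   [mu - A] would be positive definite with a bounded inverse, and [mu] could
   be lowered. *)
Lemma rayleigh A : (0 < p)%N -> A^T = A ->
  exists2 l, eigenvalue A l & forall u, bilin A u u <= l * bilin 1%:M u u.
Proof.
move=> p0 sA.
pose S := [set x | exists2 u, u != 0 & bilin A u u = x * bilin 1%:M u u]%classic.
have Sdiv u : u != 0 -> S (bilin A u u / bilin 1%:M u u).
  by move=> u0; exists u => //; rewrite divfK // gt_eqF ?bilin1_gt0.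
have [C _ leC] := bilin_bounded A.
have S_ne : (S !=set0)%classic.
  eexists; apply: (Sdiv (const_mx 1)); apply/eqP => /rowP/(_ (Ordinal p0)).
  by rewrite !mxE => /eqP; rewrite oner_eq0.
have S_ub : has_ubound S.
  exists C => x [u u0 ux]; have := leC u.
  by rewrite ux ler_pM2r // bilin1_gt0.
have le_sup u : bilin A u u <= sup S * bilin 1%:M u u.
  have [->|u0] := eqVneq u 0; first by rewrite /bilin !mul0mx mxE mulr0.
  by rewrite -ler_pdivrMr ?bilin1_gt0 // ub_le_sup //; apply: Sdiv.
exists (sup S) => //; rewrite eigenvalue_unitmx.
set P := (sup S)%:M - A.
have -> : (A - (sup S)%:M \in unitmx) = (P \in unitmx).
  by rewrite -opprB -scaleN1r unitmxZ // unitrN1.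
apply/negP => uP.
have qP u : bilin P u u = sup S * bilin 1%:M u u - bilin A u u.
  by rewrite /P bilinDm bilinNm -[(sup S)%:M]scalemx1 bilinZm.
have psP : psdmx P.
  split=> [|u]; last by rewrite qP subr_ge0.
  by rewrite /P linearB /= tr_scalar_mx sA.
have [c c0 lec] := bilin_bounded (invmx P).
(* Cauchy-Schwarz for [P] and its inverse gives [|u|^4 <= bilin P u u * c |u|^2], so every Rayleigh
   quotient of [A] stays at least [1/c] below [sup S]. *)
have : sup S <= sup S - c^-1.
  apply: ge_sup => // x [u u0 ux]; have u1 := bilin1_gt0 _ u0.
  rewrite -(ler_pM2r u1) -ux mulrBl.
  rewrite lerBrDr -lerBrDl -qP ler_pdivrMl // -(ler_pM2r u1).
  rewrite -expr2; apply: le_trans (psdmx_inv_cauchy_schwarz _ u psP uP) _.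
  by rewrite [c * _]mulrC -mulrA ler_wpM2l ?psP.2.
by rewrite lerBrDr gerDl leNgt invr_gt0 c0.
Qed.

(** Put [K = M + E]. An eigenvector [v] of its inverse satisfies [|v|^2 = a K(v)], while
    Cauchy-Schwarz gives [|v|^4 <= M(v) l |v|^2 <= l K(v) |v|^2]; dividing by [|v|^2 K(v)] compares
    [a] with [l]. *)
Lemma eigenvalue_inv_addmx_le M E l a : psdmx M -> M \in unitmx ->
    (forall u, 0 <= bilin E u u) ->
    (forall u, bilin (invmx M) u u <= l * bilin 1%:M u u) ->
  eigenvalue (invmx (M + E)) a -> a <= l.
Proof.
move=> psM uM psE lel /eigenvalueP[v va v0].
have K_gt0 u : u != 0 -> 0 < bilin (M + E) u u.
  by move=> u0; rewrite bilinDm ltr_wpDr // psdmx_unit_gt0.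
have uK := bilin_gt0_unit _ K_gt0.
have v1 := bilin1_gt0 _ v0; have vK := K_gt0 _ v0.
have aK : bilin 1%:M v v = a * bilin (M + E) v v.
  by rewrite -bilinZl -va bilin_mulmxl mulVmx.
have a0 : 0 < a by move: v1; rewrite aK pmulr_lgt0.
have l0 : 0 <= l.
  have := lel v; have := psM.2 (v *m invmx M).
  rewrite bilin_invmx ?psM.1 // => h1 h2.
  by move: (le_trans h1 h2); rewrite pmulr_lge0.
have MK : bilin M v v <= bilin (M + E) v v by rewrite bilinDm lerDl.
rewrite -(ler_pM2r vK) -aK -(ler_pM2r v1) -expr2.
apply: le_trans (psdmx_inv_cauchy_schwarz _ v psM uM) _.
apply: le_trans (ler_wpM2l (psM.2 v) (lel v)) _.
by rewrite mulrCA -mulrA ler_wpM2l // ler_wpM2r // ltW.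
Qed.

End BilinearForm.

(** * Eigenvalues of Kronecker products *)

Section TensorSpectrum.
Context {F : fieldType} {n p : nat}.
Implicit Types (J : 'M[F]_n) (A B : 'M[F]_p).

Lemma tensmxDl J1 J2 A : (J1 + J2) *t A = J1 *t A + J2 *t A.
Proof. by apply/matrixP => i j; rewrite !mxE mulrDl. Qed.

Lemma tensmxBr J A B : J *t (A - B) = J *t A - J *t B.
Proof. by apply/matrixP => i j; rewrite !mxE mulrBr. Qed.

Lemma tens1mx_scalar a : (1%:M : 'M[F]_n) *t (a%:M : 'M[F]_p) = a%:M.
Proof.
apply/matrixP => i j; case: (mxtens_indexP i) (mxtens_indexP j) => i1 i2 [j1 j2].
rewrite tensmxE !mxE (inj_eq (can_inj (@mxtens_indexK n p))) xpair_eqE.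
by rewrite mulr_natl -mulrnA mulnb andbC.
Qed.

Lemma tens1mx_unit A : A \in unitmx -> (1%:M : 'M[F]_n) *t A \in unitmx.
Proof.
move=> uA; suff /mulmx1_unit[] :
  ((1%:M : 'M[F]_n) *t A) *m (1%:M *t invmx A) = 1%:M by [].
by rewrite tensmx_mul mulmx1 mulmxV // tens1mx_scalar.
Qed.

(** If [A - a%:M] were invertible, so would be its Kronecker product with the identity, which
    annihilates [u]. *)
Lemma eigenvalue_tens1mx A a (u : 'rV[F]_(n * p)) :
  u != 0 -> u *m ((1%:M : 'M[F]_n) *t A) = a *: u -> eigenvalue A a.
Proof.
move=> u0 uA; rewrite eigenvalue_unitmx.
apply: contra u0 => /tens1mx_unit uAa; apply/eqP.
rewrite -[u](mulmxK uAa) tensmxBr mulmxBr uA tens1mx_scalar mul_mx_scalar.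
by rewrite subrr mul0mx.
Qed.

(* Both [J *t 1] and [(1 - J) *t 1] commute with the operator, so the two
   components of an eigenvector are eigenvectors unless they vanish. *)
Lemma eigenvalue_tens_idempotent J A B a : J *m J = J ->
    eigenvalue (J *t A + (1%:M - J) *t B) a ->
  eigenvalue A a \/ eigenvalue B a.
Proof.
move=> JJ /eigenvalueP[w wa w0].
have comm (K : 'M_n) C : (J *t A + (1%:M - J) *t B) *m (K *t 1%:M) = K *t C ->
    w *m (K *t 1%:M) *m (1%:M *t C) = a *: (w *m (K *t 1%:M)).
  move=> KC; rewrite -mulmxA tensmx_mul mulmx1 mul1mx -KC mulmxA wa.
  by rewrite -scalemxAl.
have JA : (J *t A + (1%:M - J) *t B) *m (J *t 1%:M) = J *t A.
  rewrite mulmxDl !tensmx_mul !mulmx1 mulmxBl mul1mx JJ subrr tens0mx.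
  by rewrite addr0.
have JB : (J *t A + (1%:M - J) *t B) *m ((1%:M - J) *t 1%:M)
    = (1%:M - J) *t B.
  rewrite mulmxDl !tensmx_mul !mulmx1 !mulmxBr !mulmx1 mulmxBl mul1mx JJ subrr.
  by rewrite tens0mx add0r subr0.
have [wJ0|wJ0] := eqVneq (w *m (J *t 1%:M)) 0; last first.
  by left; apply: (eigenvalue_tens1mx _ _ _ wJ0 (comm _ _ JA)).
right; apply: (eigenvalue_tens1mx _ _ _ _ (comm _ _ JB)).
apply: contra w0 => /eqP wK0.
rewrite -[w]mulmx1 -tens1mx_scalar -[X in X *t _](subrK J) tensmxDl.
by rewrite mulmxDr wJ0 wK0 addr0.
Qed.

(** For an eigenvector [v] of [A], the vector [e *t v] is an eigenvector: the second summand kills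
    it because [e] is fixed by [J]. *)
Lemma eigenvalue_tens_fixed J A B a (e : 'rV[F]_n) : e != 0 -> e *m J = e ->
  eigenvalue A a -> eigenvalue (J *t A + (1%:M - J) *t B) a.
Proof.
move=> /rV0Pn[i ei0] eJ /eigenvalueP[v va /rV0Pn[j vj0]].
have eva : (e *t v) *m (J *t A + (1%:M - J) *t B) = a *: (e *t v).
  rewrite mulmxDr !tensmx_mul mulmxBr mulmx1 eJ subrr tens0mx addr0 va.
  by apply/matrixP => k l; rewrite !mxE mulrCA.
apply/eigenvalueP; exists (e *t v : 'rV_(n * p)); first exact: eva.
apply/rV0Pn; exists (mxtens_index (i, j)).
by rewrite mxE mxtens_indexK !ord1 mulf_neq0.
Qed.

End TensorSpectrum.

(** [J] is the orthogonal projection onto the constant vectors; both identities come from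
    [e^T *m e = n]. *)
Lemma averaging_idempotent {R : realType} {n : nat} : (0 < n)%N ->
  let J : 'M[R]_n := n%:R^-1 *: ((const_mx 1 : 'cV_n) *m (const_mx 1)^T) in
  ((const_mx 1)^T : 'rV_n) *m J = (const_mx 1)^T /\ J *m J = J.
Proof.
move=> n0 J; set e : 'cV[R]_n := const_mx 1.
have ee : e^T *m e = n%:R%:M.
  apply/rowP => i; rewrite !mxE !ord1 eqxx (eq_bigr (fun _ => 1)).
    by rewrite sumr_const card_ord.
  by move=> k _; rewrite !mxE mulr1.
have eJ : e^T *m J = e^T.
  rewrite -scalemxAr mulmxA ee mul_scalar_mx scalerA mulVf ?scale1r //.
  by rewrite pnatr_eq0 -lt0n.
by split=> //; rewrite {1}/J -scalemxAl -mulmxA eJ.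
Qed.

(** * Comparison of the two optimality criteria *)

Section Prediction.
Context {R : realType} {X : Type} {p : nat} (f : X -> 'cV[R]_p).
Implicit Types (xi : design R X) (D Delta : 'M[R]_p).

Lemma infomx_psd xi : psdmx (infomx f xi).
Proof.
split=> [|u].
  rewrite linear_sum; apply: eq_bigr => j _.
  by rewrite linearZ /= trmx_mul trmxK.
rewrite /bilin mulmx_sumr mulmx_suml summxE sumr_ge0 // => j _.
rewrite -scalemxAr -scalemxAl mxE mulr_ge0 ?weight_ge0 //.
set y := f _; have -> : u *m (y *m y^T) *m u^T
    = (u *m y) *m (u *m y)^T by rewrite trmx_mul !mulmxA.
by rewrite mxE big_ord1 [X in _ * X]mxE -expr2 sqr_ge0.
Qed.

(** The value at [u] is that of [Delta] at [u *m invmx Delta]. *)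
Lemma posdefmx_inv_ge0 Delta u : posdefmx Delta -> 0 <= bilin (invmx Delta) u u.
Proof.
move=> [sD pD].
have qD v : v != 0 -> 0 < bilin Delta v v.
  by move=> v0; have := pD v^T; rewrite trmxK; apply; rewrite trmx_eq0.
rewrite -bilin_invmx ?bilin_gt0_unit //.
have [->|/qD/ltW //] := eqVneq (u *m invmx Delta) 0.
by rewrite /bilin !mul0mx mxE.
Qed.

Lemma posdefmxZ c D : 0 < c -> posdefmx D -> posdefmx (c *: D).
Proof.
move=> c0 [sD pD]; split=> [|v v0]; first by rewrite linearZ /= sD.
by rewrite -scalemxAr -scalemxAl mxE mulr_gt0 // pD.
Qed.

(** The equivalence serves twice: right to left it supplies the maximum for the optimal design, left
    to right it handles the competitors. *)
Lemma largest_eigenvalue_msemx n Delta xi l : (0 < n)%N -> posdefmx Delta ->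
    infomx f xi \in unitmx ->
  largest_eigenvalue (msemx f n Delta xi) l <->
  largest_eigenvalue (invmx (infomx f xi)) l.
Proof.
move=> n0 pD uM; have psM := infomx_psd xi.
have [eJ JJ] := @averaging_idempotent R n n0.
have inv_mse a : eigenvalue (invmx (infomx f xi)) a ->
    eigenvalue (msemx f n Delta xi) a.
  apply: (eigenvalue_tens_fixed _ _ _ _ _ _ eJ); apply/rV0Pn; exists (Ordinal n0).
  by rewrite !mxE oner_eq0.
have mse_inv a : eigenvalue (msemx f n Delta xi) a ->
    exists2 b, eigenvalue (invmx (infomx f xi)) b & a <= b.
  move=> /(eigenvalue_tens_idempotent _ _ _ _ JJ)[Aa|Ba]; first by exists a.
  (* A nonzero eigenvector has a nonzero coordinate, whose index witnesses [0 < p]. *)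
  have p0 : (0 < p)%N.
    rewrite lt0n; apply/eqP => p0; move: Ba => /eigenvalueP[v _ /rV0Pn[i _]].
    by move: (ltn_ord i); rewrite {2}p0.
  have [b Ab leb] := rayleigh _ p0 (invmx_sym _ psM.1).
  exists b => //; apply: (eigenvalue_inv_addmx_le _ _ _ _ _ _ _ _ Ba) => // u.
  exact: posdefmx_inv_ge0.
split=> [[/mse_inv[b Ab lb] le_l]|[Al le_l]].
  (* [b] is also an eigenvalue of the MSE matrix, so maximality of [l] yields the reverse
     inequality. *)
  have -> : l = b by apply/le_anti; rewrite lb le_l ?inv_mse.
  split=> // a Aa; apply: le_trans lb; apply: le_l; exact: inv_mse.
split=> [|a /mse_inv[b Ab]]; first exact: inv_mse.
by move=> /le_trans; apply; apply: le_l.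
Qed.

End Prediction.

Theorem corollary1 (R : realType) (X : Type) (p m n : nat)
    (f : X -> 'cV[R]_p) (D : 'M[R]_p) (hm : (0 < m)%N) (hn : (0 < n)%N)
    (hD : posdefmx D) (xi : design R X) :
  E_optimal_fixed f xi -> E_optimal_prediction f m n D xi.
Proof.
move=> [uM [l Ml l_min]]; split=> //.
have pD : posdefmx (m%:R *: D) by apply: posdefmxZ => //; rewrite ltr0n.
exists l => [|xi' l' uM']; rewrite largest_eigenvalue_msemx //.
exact: l_min.
Qed.
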